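(* Let $n$ be a positive integer and let $B=B(c_1,\dots,c_n)$ be an admissible Ferrers board, i.e. one whose $i$-th column has height $c_i$, with $0\le c_1\le c_2\le\cdots\le c_n\le n$. Then for $0\le k\le n$, the $q$-hit polynomial $T_k(B)$ is $zsu(N_k(B))$, where $$N_k(B)=\mathrm{Area}(B)+n(n-k)-\binom{n+1}{2}.$$
   Context: Squares of the $n\times n$ grid are labelled $(i,j)$ = (row, column) as for a matrix (row $1$ at the top); the board $B$ consists of the top $c_j$ squares of column $j$ for each $j$, and $\mathrm{Area}(B)=\sum_j c_j$. Write $[m]=(1-q^m)/(1-q)$ and $[k]!=\prod_{i=1}^k[i]$. Rooks are non-attacking if no two share a row or a column. The $q$-rook polynomial is $R_k(B)=\sum_C q^{\mathrm{inv}(C,B)}$, the sum over all placements $C$ of $k$ non-attacking rooks on squares of $B$, where $\mathrm{inv}(C,B)$ is the number of squares of $B$ that do not contain a rook, are not above a rook (in its column), and are not to the right of a rook (in its row). The $q$-hit polynomials are defined by $$\sum_{k=0}^n [k]!\,R_{n-k}(B)\prod_{i=k+1}^n (x-q^i)=\sum_{k=0}^n T_k(B)\,x^k .$$ For a polynomial $f(q)=\sum_{j=M}^N a_jq^j$ with $a_M\ne0$, $a_N\ne0$: $f$ is symmetric if $a_{M+k}=a_{N-k}$ for $0\le k\le N-M$; $f$ is unimodal if there is $p$ with $M\le p\le N$ and $a_M\le a_{M+1}\le\cdots\le a_p\ge a_{p+1}\ge\cdots\ge a_N$; and $\mathrm{darga}(f)=M+N$. A polynomial $f$ is $zsu(d)$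 if either $f$ is identically zero, or $f\in\mathbb N[q]$ (nonnegative integer coefficients) and $f$ is symmetric and unimodal with $\mathrm{darga}(f)=d$. *)

(* Defs.v *)
From mathcomp Require Import all_boot all_order all_algebra.

Set Implicit Arguments.
Unset Strict Implicit.
Unset Printing Implicit Defensive.

Import Order.TTheory GRing.Theory Num.Theory.
Local Open Scope ring_scope.

(* Rows and columns are numbered from 0, with row 0 at the top; a square is a
   pair (row, column), and a polynomial in q is an element of {poly int}. *)
Definition square (n : nat) := ('I_n * 'I_n)%type.

Definition board (n : nat) (c : 'I_n -> nat) : {set square n} :=
  [set s : square n | (s.1 < c s.2)%N].

Definition area (n : nat) (c : 'I_n -> nat) : nat := (\sum_(j < n) c j)%N.

Definition admissible (n : nat) (c : 'I_n -> nat) : Prop :=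
  (forall i j : 'I_n, (i <= j)%N -> (c i <= c j)%N) /\
  (forall j : 'I_n, (c j <= n)%N).

Definition nonattacking (n : nat) (C : {set square n}) : bool :=
  [forall s in C, forall t in C,
    (s != t) ==> (s.1 != t.1) && (s.2 != t.2)].

Definition above_rook (n : nat) (C : {set square n}) (s : square n) : bool :=
  [exists t in C, (t.2 == s.2) && (s.1 < t.1)%N].

Definition right_of_rook (n : nat) (C : {set square n}) (s : square n) : bool :=
  [exists t in C, (t.1 == s.1) && (t.2 < s.2)%N].

Definition rook_inv (n : nat) (C B : {set square n}) : nat :=
  #|[set s in B | [&& s \notin C, ~~ above_rook C s & ~~ right_of_rook C s]]|.

Definition qrook (n : nat) (k : nat) (B : {set square n}) : {poly int} :=
  \sum_(C : {set square n} | [&& C \subset B, #|C| == k & nonattacking C])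
    'X^(rook_inv C B).

Definition qint (m : nat) : {poly int} := \sum_(i < m) 'X^i.

Lemma qintE (m : nat) : (1 - 'X) * qint m = 1 - 'X^m.
Proof. by rewrite -opprB mulNr /qint -subrX1 opprB. Qed.

Definition qfact (k : nat) : {poly int} := \prod_(1 <= i < k.+1) qint i.

(* The outer variable is x and the coefficients are polynomials in q, so that
   ('X^i)%:P is q^i. *)
Definition qhit_gen (n : nat) (B : {set square n}) : {poly {poly int}} :=
  \sum_(k < n.+1) (qfact k * qrook (n - k) B)%:P *
    \prod_(k.+1 <= i < n.+1) ('X - ('X^i)%:P).

Definition qhit (n : nat) (k : nat) (B : {set square n}) : {poly int} :=
  (qhit_gen B)`_k.

Lemma qhit_genE (n : nat) (B : {set square n}) :
  qhit_gen B = \sum_(k < n.+1) (qhit k B)%:P * 'X^k.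
Proof.
have szG : (size (qhit_gen B) <= n.+1)%N.
  apply: (leq_trans (size_sum _ _ _)); apply/bigmax_leqP => k _.
  rewrite mul_polyC; apply: (leq_trans (size_scale_leq _ _)).
  by rewrite size_prod_XsubC size_iota ltnS; apply: leq_subr.
under eq_bigr do rewrite mul_polyC.
rewrite -poly_def; apply/polyP => i; rewrite coef_poly.
by case: ltnP => // lt_ni; rewrite nth_default // (leq_trans szG).
Qed.

(* For f != 0, lowdeg f and (size f).-1 are the least and the greatest exponent
   occurring in f. *)
Definition lowdeg (f : {poly int}) : nat := find (fun a : int => a != 0) f.

Definition darga (f : {poly int}) : nat := (lowdeg f + (size f).-1)%N.

Definition symmetric_poly (f : {poly int}) : Prop :=
  let M := lowdeg f in let N := (size f).-1 in
  forall k : nat, (k <= N - M)%N -> f`_(M + k) = f`_(N - k).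

Definition unimodal_poly (f : {poly int}) : Prop :=
  let M := lowdeg f in let N := (size f).-1 in
  exists p : nat,
    [/\ (M <= p <= N)%N,
        forall i : nat, (M <= i < p)%N -> f`_i <= f`_i.+1
      & forall i : nat, (p <= i < N)%N -> f`_i.+1 <= f`_i].

Definition zsu (d : int) (f : {poly int}) : Prop :=
  f = 0 \/
  [/\ f \is a polyOver Num.nat, symmetric_poly f, unimodal_poly f
    & (darga f)%:Z = d].

(* An integer, not a truncated difference: it can be negative, and then
   zsu (hit_darga k c) only holds of the zero polynomial. *)
Definition hit_darga (n : nat) (k : nat) (c : 'I_n -> nat) : int :=
  (area c)%:Z + n%:Z * (n%:Z - k%:Z) - 'C(n.+1, 2)%:Z.

(* Main.v *)
Require Import Defs.
From mathcomp Require Import all_boot all_order all_algebra.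
From mathcomp Require Import zify ring.

(* Write c_0 <= ... <= c_(n-1) for the column heights and a_i = c_i - i.  Since
   R_k satisfies the Garsia-Remmel factorisation
     sum_k R_(n-k) [m][m-1]...[m-k+1] = prod_i [m + a_i],
   the polynomials T_t are determined by the q-Worpitzky identity
     sum_t T_t qbin(m + t, n) = prod_i [m + a_i]   for all m >= 0,
   which depends only on the multiset of the a_i.  Inserting a new factor [m + a]
   replaces the family p_j = T_(n-j) by
     p'_j = [a + j] p_j + q^(a+j-1) [n + 2 - a - j] p_(j-1)
   (n is the number of factors already present), and both terms are symmetric and
   unimodal about the same centre, provided that a + j and n + 2 - a - j are
   nonnegative wherever p does not vanish.  Adding the columns from left to right
   violates this, but the a_i start at a_0 >= 0, end at a_(n-1) <= 1 and decrease
   by at most 1 at each step, so if a > 1 occurs then so does a - 1, and if a < 0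
   occurs then so does a + 1.  Inserting the a_i by increasing |2a - 1| then forces
   enough of the p_j to vanish. *)

Set Implicit Arguments.
Unset Strict Implicit.
Unset Printing Implicit Defensive.

Import Order.TTheory GRing.Theory Num.Theory.
Local Open Scope ring_scope.

(** * q-integers and q-binomials *)

Lemma qint0 : qint 0 = 0.
Proof. by rewrite /qint big_ord0. Qed.

Lemma qint1 : qint 1 = 1.
Proof. by rewrite /qint big_ord1 expr0. Qed.

Lemma qintD (m p : nat) : qint (m + p) = qint m + 'X^m * qint p.
Proof.
rewrite /qint big_split_ord /= mulr_sumr; congr (_ + _).
by apply: eq_bigr => i _; rewrite exprD.
Qed.

Lemma qintS_neq0 (m : nat) : qint m.+1 != 0.
Proof.
apply/eqP => /(congr1 (horner^~ 0)); rewrite -addn1 addnC qintD qint1.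
by rewrite !hornerE /= => /eqP; rewrite oner_eq0.
Qed.

Fixpoint qbin (m k : nat) : {poly int} :=
  match m, k with
  | _, 0 => 1
  | 0, _.+1 => 0
  | m'.+1, k'.+1 => qbin m' k' + 'X^(k'.+1) * qbin m' k'.+1
  end.

Lemma qbin0 (m : nat) : qbin m 0 = 1. Proof. by case: m. Qed.

Lemma qbinS (m k : nat) :
  qbin m.+1 k.+1 = qbin m k + 'X^(k.+1) * qbin m k.+1.
Proof. by []. Qed.

Lemma qbin_small (m k : nat) : (m < k)%N -> qbin m k = 0.
Proof.
elim: m k => [|m IH] [|k] //= lt_mk.
by rewrite !IH ?mulr0 ?addr0 // ltnW.
Qed.

Lemma qbinn (m : nat) : qbin m m = 1.
Proof. by elim: m => //= m ->; rewrite qbin_small // mulr0 addr0. Qed.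

Arguments qbin : simpl never.

(** Links the two absorption identities at the same [m], so that the induction proving
    [mul_qbin_left] can use both. *)
Lemma mul_qbin_diag_of_left (m k : nat) :
  qint k.+1 * qbin m k.+1 = qint (m - k) * qbin m k ->
  qint k.+1 * qbin m.+1 k.+1 = qint m.+1 * qbin m k.
Proof.
move=> IH; have [le_km|lt_mk] := leqP k m; last first.
  by rewrite !qbin_small ?mulr0 // ltnW.
rewrite qbinS mulrDr mulrCA IH.
have -> : m.+1 = (k.+1 + (m - k))%N by lia.
by rewrite qintD; ring.
Qed.

Lemma mul_qbin_left (m k : nat) :
  qint k.+1 * qbin m k.+1 = qint (m - k) * qbin m k.
Proof.
elim: m k => [|m IH] [|k]; rewrite ?mulr0 ?sub0n ?qint0 ?mul0r //.
  by rewrite (mul_qbin_diag_of_left (IH 0)) !qbin0 subn0.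
rewrite (mul_qbin_diag_of_left (IH k.+1)) subSS.
apply: (mulfI (qintS_neq0 k)).
by rewrite mulrCA IH [RHS]mulrCA (mul_qbin_diag_of_left (IH k)) mulrCA.
Qed.

Lemma mul_qbin_diag (m k : nat) :
  qint k.+1 * qbin m.+1 k.+1 = qint m.+1 * qbin m k.
Proof. exact/mul_qbin_diag_of_left/mul_qbin_left. Qed.

(** The identity behind the insertion recurrence. Multiplied by [k+1], each binomial becomes a
    multiple of [qbin (k + m) k]; with b = k+1-a there remains [a+b][m+a] = [a][a+b+m] + q^a
    [b][m]. *)
Lemma qint_mul_qbin (k m a : nat) : (a <= k.+1)%N ->
  qint (m + a) * qbin (k + m) k =
  qint a * qbin (k.+1 + m) k.+1 + 'X^a * qint (k.+1 - a) * qbin (k + m) k.+1.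
Proof.
move=> le_ak; apply: (mulfI (qintS_neq0 k)).
have [b def_k] : exists b, k.+1 = (a + b)%N by exists (k.+1 - a)%N; lia.
rewrite mulrDr (mulrCA _ (qint a)) (mulrCA _ ('X^a * _)).
rewrite addSn mul_qbin_diag mul_qbin_left addKn -addSn def_k addKn.
rewrite -addnA (addnC m a) !qintD.
have comm : qint b + 'X^b * qint a = qint a + 'X^a * qint b.
  by rewrite -!qintD addnC.
transitivity (qbin (k + m) k * (qint a * qint a + 'X^a * qint a * qint b +
    'X^a * qint m * (qint a + 'X^a * qint b))); first by ring.
by rewrite -comm; ring.
Qed.

(** The falling q-factorial. For k > m the factor at i = m is zero, so the truncated differences
    beyond it are harmless. *)
Definition qffact (m k : nat) : {poly int} := \prod_(i < k) qint (m - i).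

Lemma qffactS (m k : nat) : qffact m k.+1 = qffact m k * qint (m - k).
Proof. by rewrite /qffact big_ord_recr. Qed.

Lemma qffact_small (m k : nat) : (m < k)%N -> qffact m k = 0.
Proof.
move=> lt_mk; rewrite /qffact (bigD1 (Ordinal lt_mk)) //= subnn qint0.
by rewrite mul0r.
Qed.

Lemma qfact_qbin (m k : nat) : qfact k * qbin m k = qffact m k.
Proof.
elim: k => [|k IH]; first by rewrite /qfact /qffact big_geq // big_ord0 qbin0 mulr1.
rewrite qffactS -IH /qfact big_nat_recr //= -mulrA mul_qbin_left.
by rewrite -mulrA [qint (m - k) * _]mulrC.
Qed.

(** * Polynomials with centred symmetric unimodal coefficients *)

(* Coefficients indexed by all integers, so that reflection about d / 2 is total. *)
Definition coefz (f : {poly int}) (i : int) : int :=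
  if i is Posz k then f`_k else 0.

Definition peaked (d : int) (g : int -> int) : Prop :=
  forall i j : int, `|2 * j - d| <= `|2 * i - d| -> g i <= g j.

(* Comparing with far away indices gives f >= 0; d < 0 forces f = 0. *)
Definition centered (d : int) (f : {poly int}) : Prop := peaked d (coefz f).

Lemma peaked_sym (d : int) (g : int -> int) : peaked d g ->
  forall i, g (d - i) = g i.
Proof. by move=> gP i; apply/eqP; rewrite eq_le !gP //; lia. Qed.

Lemma peaked_step (d : int) (g : int -> int) :
  (forall i, g (d - i) = g i) ->
  (forall i, 2 * i + 1 <= d -> g i <= g (i + 1)) -> peaked d g.
Proof.
move=> gsym gle.
have mono : forall (k : nat) i, 2 * (i + k%:Z) <= d -> g i <= g (i + k%:Z).
  elim=> [|k IH] i le_id; first by rewrite addr0.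
  have -> : i + k.+1%:Z = i + k%:Z + 1 by lia.
  by apply: (le_trans (IH i _)); [lia|apply: gle; lia].
have mono2 : forall i j, i <= j -> 2 * j <= d -> g i <= g j.
  move=> i j le_ij le_jd; have -> : j = i + `|j - i|%N%:Z by lia.
  by apply: mono; lia.
(* Reflection brings any index into the left half at the same distance from d / 2, so monotonicity
   there suffices. *)
have fold i : exists2 i', `|2 * i' - d| = `|2 * i - d| /\ 2 * i' <= d & g i = g i'.
  have [le_id|lt_di] := leP (2 * i) d; first by exists i.
  by exists (d - i); rewrite ?gsym //; lia.
move=> i j; have [i' [<- le_i'] ->] := fold i; have [j' [<- le_j'] ->] := fold j.
by move=> le_ji; apply: mono2; lia.
Qed.

Lemma centered0 (d : int) : centered d 0.
Proof. by move=> [i|i] [j|j]; rewrite /= ?coef0. Qed.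

Lemma centeredD (d : int) (f g : {poly int}) :
  centered d f -> centered d g -> centered d (f + g).
Proof.
have E i : coefz (f + g) i = coefz f i + coefz g i.
  by case: i => i /=; rewrite ?coefD ?addr0.
by move=> fP gP i j le_ji; rewrite !E lerD ?fP ?gP.
Qed.

Lemma coefz_XnM (f : {poly int}) (k : nat) (i : int) :
  coefz ('X^k * f) i = coefz f (i - k%:Z).
Proof.
case: i => i /=; last by have -> : Negz i - k%:Z = Negz (i + k) by lia.
rewrite coefXnM; case: ltnP => [lt_ik|le_ki].
  by have -> : i%:Z - k%:Z = Negz (k - i).-1 by lia.
by have -> : i%:Z - k%:Z = (i - k)%N%:Z by lia.
Qed.

Lemma centeredXn (d : int) (f : {poly int}) (k : nat) :
  centered d f -> centered (d + 2 * k%:Z) ('X^k * f).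
Proof. by move=> fP i j le_ji; rewrite !coefz_XnM; apply: fP; lia. Qed.

Lemma coefz_qintM (f : {poly int}) (m : nat) (i : int) :
  coefz (qint m * f) i = \sum_(t < m) coefz f (i - t%:Z).
Proof.
rewrite /qint mulr_suml.
have -> : forall F : 'I_m -> {poly int},
    coefz (\sum_(t < m) F t) i = \sum_(t < m) coefz (F t) i.
  by case: i => i F /=; rewrite ?coef_sum // big1.
by apply: eq_bigr => t _; rewrite coefz_XnM.
Qed.

(** Each coefficient of the product is a sum over a window of m consecutive coefficients of f.
    Sliding the window by one gains index i+1 and loses i+1-m, and left of the new centre the gained
    index is the one closer to d / 2. *)
Lemma centered_qint (d : int) (f : {poly int}) (m : nat) :
  centered d f -> centered (d + m%:Z - 1) (qint m * f).
Proof.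
move=> fP; apply: peaked_step => i => [|le_i]; rewrite !coefz_qintM.
  rewrite (reindex_inj rev_ord_inj) /=; apply: eq_bigr => t _.
  by rewrite -(peaked_sym fP); congr coefz; have := ltn_ord t; lia.
have win : \sum_(t < m) coefz f (i + 1 - t%:Z) + coefz f (i + 1 - m%:Z) =
           \sum_(t < m) coefz f (i - t%:Z) + coefz f (i + 1).
  rewrite -(big_ord_recr m (fun t => coefz f (i + 1 - t%:Z))) /=.
  rewrite big_ord_recl /= subr0 addrC; congr (_ + _).
  by apply: eq_bigr => t _; congr coefz; rewrite /bump /=; lia.
by rewrite -(lerD2r (coefz f (i + 1))) -win lerD2l; apply: fP; lia.
Qed.

Lemma centered_zsu (d : int) (f : {poly int}) : centered d f -> zsu d f.
Proof.
move=> fP; have [->|f_neq0] := eqVneq f 0; [by left|right].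
have f_ge0 i : 0 <= f`_i.
  by apply: (fP (Negz (i + `|d|)) i); rewrite NegzE; lia.
have szf : (0 < size f)%N by rewrite lt0n size_poly_eq0.
have fN : f`_(size f).-1 != 0 by rewrite -lead_coefE lead_coef_eq0.
have hasf : has (fun a : int => a != 0) f.
  by apply/hasP; exists (lead_coef f); rewrite ?lead_coef_eq0 ?mem_nth // prednK.
have fM : f`_(lowdeg f) != 0 by apply: (nth_find 0 hasf).
have le_M i : f`_i != 0 -> (lowdeg f <= i)%N.
  by apply: contraNT; rewrite -ltnNge => /(before_find 0) /negbFE.
have le_N i : f`_i != 0 -> (i <= (size f).-1)%N.
  by apply: contraNT; rewrite -ltnNge prednK // => /(nth_default 0) ->.
(* The support is stable under reflection about d / 2, which forces the extreme exponents to add up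
   to d. *)
have reflect_coef i : f`_i != 0 -> exists2 k : nat, d - i%:Z = k%:Z & f`_k != 0.
  have := peaked_sym fP i; rewrite [coefz f i]/=.
  by case: (d - i%:Z) => k /= <- //; exists k.
have dargaE : (lowdeg f)%:Z + (size f).-1%:Z = d.
  have [k1 dk1 /le_N le1] := reflect_coef _ fM.
  by have [k2 dk2 /le_M le2] := reflect_coef _ fN; lia.
have le_MN := le_N _ fM.
split=> //.
- by apply/polyOverP => i; rewrite natrEint f_ge0 -[f`_i]intz intr_int.
- rewrite /symmetric_poly.
  move: ((size f).-1) (lowdeg f) dargaE le_MN => N M dargaE le_MN k le_k.
  have := peaked_sym fP (M + k)%N.
  by have -> /= : d - (M + k)%N%:Z = (N - k)%N%:Z by lia.
- rewrite /unimodal_poly.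
  move: ((size f).-1) (lowdeg f) dargaE le_MN => N M dargaE le_MN.
  exists ((M + N)./2); split; first by lia.
  + by move=> i le_i; apply: (fP i i.+1); lia.
  + by move=> i le_i; apply: (fP i.+1 i); lia.
Qed.

(** * q-hit polynomials and the q-Worpitzky identity *)

(* Dual to the products that define the q-hit polynomials: applied to them, it
   satisfies the q-Pascal recurrence. *)
Definition qbin_eval (n m : nat) (Q : {poly {poly int}}) : {poly int} :=
  \sum_(t < n.+1) Q`_t * qbin (m + t) n.

Lemma qbin_eval_lin (n m : nat) (I : Type) (r : seq I) (a : I -> {poly int})
    (Q : I -> {poly {poly int}}) :
  qbin_eval n m (\sum_(i <- r) (a i)%:P * Q i) =
  \sum_(i <- r) a i * qbin_eval n m (Q i).
Proof.
rewrite /qbin_eval.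
under [RHS]eq_bigr do rewrite mulr_sumr.
rewrite exchange_big /=; apply: eq_bigr => t _.
rewrite coef_sum mulr_suml; apply: eq_bigr => i _.
by rewrite coefCM mulrA.
Qed.

(** Multiplication by x shifts coefficients, hence moves the evaluation from m to m+1; the size
    bound keeps the shifted top coefficient within the range of the sum. *)
Lemma qbin_eval_XsubC (n m k : nat) (Q : {poly {poly int}}) :
  (size Q <= n)%N ->
  qbin_eval n m (('X - ('X^k)%:P) * Q) =
  qbin_eval n m.+1 Q - 'X^k * qbin_eval n m Q.
Proof.
move=> szQ; rewrite /qbin_eval mulrBl.
under eq_bigr do rewrite coefB mulrBl coefXM coefCM -mulrA.
rewrite sumrB -mulr_sumr; congr (_ - _).
rewrite big_ord_recl mul0r add0r [RHS]big_ord_recr.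
rewrite /= (nth_default 0 szQ) mul0r addr0.
by apply: eq_bigr => i _; rewrite /bump add1n addnS.
Qed.

(** The empty product gives [qbin m n], and by q-Pascal each further factor x - q^(k+1) lowers the
    bottom index from k+1 to k. *)
Lemma qbin_eval_prod (n k m : nat) : (k <= n)%N ->
  qbin_eval n m (\prod_(k.+1 <= i < n.+1) ('X - ('X^i)%:P)) = qbin m k.
Proof.
move=> le_kn; have [d def_n] : exists d, n = (k + d)%N by exists (n - k)%N; lia.
elim: d k m le_kn def_n => [|d IH] k m le_kn def_n.
  rewrite def_n addn0 big_geq // /qbin_eval (bigD1 ord0) //= coef1 mul1r addn0.
  rewrite big1 ?addr0 // => i; rewrite coef1 -val_eqE /= => /negPf ->.
  by rewrite mul0r.
rewrite big_ltn; last by lia.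
rewrite qbin_eval_XsubC; last first.
  by rewrite size_prod_XsubC size_iota; lia.
by rewrite !IH ?qbinS ?addrK //; lia.
Qed.

Lemma qbin_eval_hit (n m : nat) (B : {set square n}) :
  qbin_eval n m (qhit_gen B) = \sum_(k < n.+1) qrook (n - k) B * qffact m k.
Proof.
rewrite /qhit_gen qbin_eval_lin; apply: eq_bigr => k _.
have le_kn : (k <= n)%N by rewrite -ltnS.
by rewrite qbin_eval_prod // [qfact k * _]mulrC -mulrA qfact_qbin.
Qed.

(** The system is unitriangular: [qbin (m + t) n] is 0 for t < n-m and 1 for t = n-m, so m = 0, 1,
    ..., n yield the coefficients from the top down. *)
Lemma qbin_eval_inj (n : nat) (P Q : {poly {poly int}}) :
  (forall m, qbin_eval n m P = qbin_eval n m Q) ->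
  forall t, (t <= n)%N -> P`_t = Q`_t.
Proof.
move=> eqPQ t le_tn; have -> : t = (n - (n - t))%N by lia.
elim/ltn_ind: (n - t)%N (leq_subr t n) => m IH le_mn.
have tP : (n - m < n.+1)%N by lia.
have splitE R : qbin_eval n m R =
    R`_(n - m) + \sum_(i < n.+1 | i != Ordinal tP) R`_i * qbin (m + i) n.
  by rewrite /qbin_eval (bigD1 (Ordinal tP)) //= subnKC // qbinn mulr1.
have := eqPQ m; rewrite !splitE.
suff -> : \sum_(i < n.+1 | i != Ordinal tP) P`_i * qbin (m + i) n =
          \sum_(i < n.+1 | i != Ordinal tP) Q`_i * qbin (m + i) n.
  by move/addIr.
apply: eq_bigr => i; rewrite -val_eqE /= => ne_i.
have [lt_i|le_i] := ltnP i (n - m); first by rewrite qbin_small ?mulr0 //; lia.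
have := ltn_ord i => lt_in.
have -> : nat_of_ord i = (n - (n - i))%N by lia.
by rewrite IH //; lia.
Qed.

(** * The Garsia-Remmel factorisation *)

Lemma sum_rank_qint (n : nat) (F : {set 'I_n}) :
  \sum_(r in F) 'X^(#|[set r' in F | (r < r')%N]|) = qint #|F|.
Proof.
have [k] := ubnP #|F|; elim: k F => // k IH F lt_Fk.
have [->|[x0 x0F]] := set_0Vmem F; first by rewrite big_set0 cards0 qint0.
(* Removing the least element x leaves the other exponents unchanged, and x itself contributes
   q^(#|F| - 1). *)
case: (arg_minnP (fun r : 'I_n => nat_of_ord r) x0F) => x.
rewrite -[_ x]/(x \in F) => xF x_min.
rewrite (big_setD1 x) //= (cardsD1 x F) xF add1n.
rewrite -[in RHS]addn1 qintD qint1 mulr1 [RHS]addrC; congr (_ + _).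
  congr ('X^_); apply: eq_card => r; rewrite !inE andbC; apply: andb_id2r => rF.
  by rewrite ltn_neqAle x_min // andbT eq_sym.
rewrite -IH; last by move: lt_Fk; rewrite (cardsD1 x F) xF.
apply: eq_bigr => r /setD1P[_ rF]; congr ('X^_); apply: eq_card => r'.
rewrite !inE; case: eqVneq => [->|_] //=.
by rewrite xF ltnNge x_min.
Qed.

Lemma nonattackingP (n : nat) (C : {set square n}) :
  reflect ({in C &, injective fst} /\ {in C &, injective snd}) (nonattacking C).
Proof.
apply: (iffP forall_inP) => [natt|[inj1 inj2] s sC].
  have att s t : s \in C -> t \in C -> s != t -> (s.1 != t.1) && (s.2 != t.2).
    by move=> sC tC; apply/implyP; move/forall_inP: (natt s sC); apply.
  split=> s t sC tC eq_st; apply/eqP; apply: contraT => /(att _ _ sC tC);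
  by rewrite eq_st eqxx ?andbF.
apply/forall_inP => t tC; apply/implyP => ne_st.
by apply/andP; split; apply: contraNneq ne_st => eq_st; apply/eqP; auto.
Qed.

Definition col_board (n : nat) (c : 'I_n -> nat) (j : nat) : {set square n} :=
  [set s in board c | (s.2 < j)%N].

Definition rook_rows (n : nat) (C : {set square n}) : {set 'I_n} :=
  [set s.1 | s in C].

Definition free_rows (n : nat) (c : 'I_n -> nat) (j : 'I_n) (C : {set square n}) :=
  [set r : 'I_n | (r < c j)%N && (r \notin rook_rows C)].

Lemma card_ord_ltn (n k : nat) : (k <= n)%N -> #|[set i : 'I_n | (i < k)%N]| = k.
Proof.
move=> le_kn; rewrite -sum1_card; under eq_bigl do rewrite inE.
by rewrite (big_ord_narrow le_kn) sum1_card card_ord.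
Qed.

Lemma card_rooks_le (n : nat) (c : 'I_n -> nat) (j : nat) (C : {set square n}) :
  (j <= n)%N -> C \subset col_board c j -> nonattacking C -> (#|C| <= j)%N.
Proof.
move=> le_jn /subsetP CB /nonattackingP[_ inj2].
rewrite -(card_in_imset inj2) -[leqRHS](card_ord_ltn le_jn).
apply/subset_leq_card/subsetP => i /imsetP[s /CB]; rewrite !inE => /andP[_ lt_s].
by move=> ->.
Qed.

(** As heights increase, every rook of C lies in a row that meets column j inside the board, and
    distinct rooks block distinct rows. *)
Lemma card_free_rows (n : nat) (c : 'I_n -> nat) (j : 'I_n) (C : {set square n}) :
  admissible c -> C \subset col_board c j -> nonattacking C ->
  (#|C| + #|free_rows c j C|)%N = c j.
Proof.
move=> [c_mono c_le] /subsetP CB /nonattackingP[inj1 _].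
rewrite -[RHS](card_ord_ltn (c_le j)) -(card_in_imset inj1).
rewrite -(cardsID (rook_rows C) [set i : 'I_n | (i < c j)%N]); congr (_ + _)%N.
  apply: eq_card => r; rewrite !inE; apply/idP/andP => [rC|[]//]; split=> //.
  have /imsetP[s /CB] := rC; rewrite !inE => /andP[lt_s lt_sj ->].
  by apply: leq_trans lt_s (c_mono _ _ (ltnW lt_sj)).
by apply: eq_card => r; rewrite !inE andbC.
Qed.

(** Cancellation acts only within a column or to the right, so earlier columns do not see column j;
    in column j the squares right of a rook are those in rows used by C. *)
Lemma rook_inv_split (n : nat) (c : 'I_n -> nat) (j : 'I_n) (C D : {set square n}) :
  D :&: col_board c j = C -> D \subset col_board c j.+1 ->
  rook_inv D (col_board c j.+1) =
  (rook_inv C (col_board c j) +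
   #|[set r in free_rows c j C | ((r, j) \notin D) && ~~ above_rook D (r, j)]|)%N.
Proof.
move=> defC /subsetP DB.
have memC t : t \in D -> (t.2 < j)%N -> t \in C.
  move=> tD lt_tj; rewrite -defC inE tD /= inE lt_tj andbT.
  by have := DB t tD; rewrite inE => /andP[].
have CD t : t \in C -> t \in D /\ (t.2 < j)%N.
  by rewrite -defC !inE => /and3P[].
rewrite /rook_inv -(cardsID (col_board c j)); congr (_ + _)%N.
  apply: eq_card => s; rewrite !inE.
  case lt_sj: (s.2 < j)%N; rewrite !(andbT, andbF) //= ltnS (ltnW lt_sj) andbT.
  case: (s.1 < c s.2)%N => //=; rewrite andbT; congr [&& ~~ _, ~~ _ & ~~ _].
  - by apply/idP/idP => [/memC|/CD[]//]; apply.
  - by apply/exists_inP/exists_inP => -[t tX /andP[/eqP eq_ts lt_st]];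
      exists t; rewrite ?eq_ts ?eqxx //; [apply: memC; rewrite ?eq_ts|case: (CD t tX)].
  - by apply/exists_inP/exists_inP => -[t tX /andP[/eqP eq_ts lt_ts]];
      exists t; rewrite ?eq_ts ?eqxx //;
      [apply: memC => //; apply: ltn_trans lt_sj|case: (CD t tX)].
rewrite -(card_imset _ (_ : injective (fun r : 'I_n => (r, j)))); last by move=> r r' [].
apply: eq_card => -[r i]; apply/idP/imsetP.
  rewrite !inE /= ltnS => /andP[lt_i /and3P[/andP[lt_r le_ij] nD /andP[nab nri]]].
  have def_i : i = j.
    by apply/val_inj/eqP; rewrite eqn_leq le_ij leqNgt; rewrite lt_r in lt_i.
  exists r; last by rewrite def_i.
  rewrite def_i in lt_r nD nab nri *; rewrite !inE lt_r nD nab /= andbT.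
  apply: contra nri => /imsetP[s /CD[sD lt_sj] def_r].
  by apply/exists_inP; exists s; rewrite //= def_r eqxx.
case=> r'; rewrite !inE /= => /andP[/andP[lt_r nrow] /andP[nD nab]] [-> ->].
rewrite ltnn andbF lt_r ltnSn nD nab /=; apply: contra nrow.
case/exists_inP => s sD /= /andP[/eqP def_r lt_sj].
by rewrite -def_r; apply: imset_f; apply: memC.
Qed.

Lemma col_board_sub (n : nat) (c : 'I_n -> nat) (i j : nat) :
  (i <= j)%N -> col_board c i \subset col_board c j.
Proof.
move=> le_ij; apply/subsetP => s; rewrite !inE => /andP[-> lt_si] /=.
exact: leq_trans lt_si le_ij.
Qed.

Lemma nonattacking_sub (n : nat) (C D : {set square n}) :
  C \subset D -> nonattacking D -> nonattacking C.
Proof.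
move=> /subsetP CD /nonattackingP[inj1 inj2]; apply/nonattackingP.
by split=> s t /CD sD /CD tD; [apply: inj1|apply: inj2].
Qed.

Lemma rook_inv_no_rook (n : nat) (c : 'I_n -> nat) (j : 'I_n) (C : {set square n}) :
  C \subset col_board c j ->
  rook_inv C (col_board c j.+1) = (rook_inv C (col_board c j) + #|free_rows c j C|)%N.
Proof.
move=> CB; rewrite (@rook_inv_split _ c j C C); first last.
- exact: subset_trans CB (col_board_sub _ (leqnSn j)).
- exact/setIidPl.
have noj r i : (r, i) \in C -> (i < j)%N.
  by move/(subsetP CB); rewrite !inE => /andP[].
congr (_ + _)%N; apply: eq_card => r; rewrite !inE; apply: andb_idr => _.
apply/andP; split; first by apply/negP => /noj; rewrite ltnn.
apply/exists_inP => -[[r' i] /noj lt_ij /= /andP[/eqP eq_ij]].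
by rewrite eq_ij ltnn in lt_ij.
Qed.

Lemma last_col_notin (n : nat) (c : 'I_n -> nat) (j : 'I_n) (C : {set square n})
    (r : 'I_n) :
  C \subset col_board c j -> (r, j) \notin C.
Proof. by move=> CB; apply/negP => /(subsetP CB); rewrite !inE ltnn andbF. Qed.

Lemma card_add_rook (n : nat) (c : 'I_n -> nat) (j : 'I_n) (C : {set square n})
    (r : 'I_n) :
  C \subset col_board c j -> #|(r, j) |: C| = #|C|.+1.
Proof.
by move=> CB; rewrite cardsU1 (last_col_notin r CB).
Qed.

Lemma add_rook_trunc (n : nat) (c : 'I_n -> nat) (j : 'I_n) (C : {set square n})
    (r : 'I_n) :
  C \subset col_board c j -> ((r, j) |: C) :&: col_board c j = C.
Proof.
move=> CB; apply/setP => s; rewrite !inE; case: eqVneq => [->|_] /=.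
  by rewrite ltnn andbF (negPf (last_col_notin r CB)).
by apply: andb_idr => /(subsetP CB); rewrite !inE.
Qed.

Lemma add_rook_board (n : nat) (c : 'I_n -> nat) (j : 'I_n) (C : {set square n})
    (r : 'I_n) :
  C \subset col_board c j -> r \in free_rows c j C ->
  (r, j) |: C \subset col_board c j.+1.
Proof.
move=> CB; rewrite !inE => /andP[lt_r _]; rewrite subUset sub1set !inE /= lt_r ltnSn.
exact: subset_trans CB (col_board_sub _ (leqnSn j)).
Qed.

Lemma add_rook_nonattacking (n : nat) (c : 'I_n -> nat) (j : 'I_n) (C : {set square n})
    (r : 'I_n) :
  C \subset col_board c j -> nonattacking C -> r \in free_rows c j C ->
  nonattacking ((r, j) |: C).
Proof.
move=> CB /nonattackingP[inj1 inj2]; rewrite inE => /andP[_ nrow].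
have nr s : s \in C -> r <> s.1.
  by move=> sC eq_r; rewrite eq_r imset_f in nrow.
have nj s : s \in C -> j <> s.2.
  move=> /(subsetP CB); rewrite !inE => /andP[_ lt_sj] eq_j.
  by rewrite eq_j ltnn in lt_sj.
apply/nonattackingP; split=> s t /setU1P[->|sC] /setU1P[->|tC] //= eq_st.
- by case: (nr t tC).
- by case: (nr s sC).
- exact: inj1.
- by case: (nj t tC).
- by case: (nj s sC).
- exact: inj2.
Qed.

Lemma rook_inv_add_rook (n : nat) (c : 'I_n -> nat) (j : 'I_n) (C : {set square n})
    (r : 'I_n) :
  C \subset col_board c j -> r \in free_rows c j C ->
  rook_inv ((r, j) |: C) (col_board c j.+1) =
  (rook_inv C (col_board c j) + #|[set r' in free_rows c j C | (r < r')%N]|)%N.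
Proof.
move=> CB r_free.
rewrite (rook_inv_split (add_rook_trunc r CB) (add_rook_board CB r_free)).
congr (_ + _)%N; apply: eq_card => r'; rewrite !inE; apply: andb_id2l => _.
have -> : (r', j) == (r, j) = (r' == r) by rewrite xpair_eqE eqxx andbT.
rewrite (negPf (last_col_notin r' CB)) orbF ltn_neqAle [in RHS]leqNgt eq_sym.
congr (~~ _ && ~~ _).
apply/exists_inP/idP => [[[r1 j1] /setU1P[[-> _]|mem_C] /= /andP[/eqP eq_j //]]|lt_r].
  by rewrite eq_j (negPf (last_col_notin r1 CB)) in mem_C.
by exists (r, j); rewrite ?setU11 //= eqxx.
Qed.

Lemma add_rook_reverse (n : nat) (c : 'I_n -> nat) (j : 'I_n) (C : {set square n})
    (D : {set square n}) :
  C \subset col_board c j -> D \subset col_board c j.+1 -> nonattacking D ->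
  D :&: col_board c j = C -> D != C ->
  exists2 r, r \in free_rows c j C & D = (r, j) |: C.
Proof.
move=> CB /subsetP DB /nonattackingP[inj1 inj2] defC neDC.
have inC s : s \in D -> s \notin C -> s = (s.1, j).
  move=> sD; rewrite -defC !inE sD; have := DB s sD; rewrite !inE ltnS.
  case: s {sD} => r i /= /andP[-> le_ij] /=; rewrite -leqNgt => le_ji.
  by congr (_, _); apply/val_inj/eqP; rewrite eqn_leq le_ij.
have CD : C \subset D by rewrite -defC subsetIl.
have /subsetPn[s sD sC] : ~~ (D \subset C).
  by apply: contra neDC => DC; rewrite eqEsubset DC.
have def_s := inC s sD sC.
exists s.1.
  rewrite inE; have := DB s sD; rewrite def_s !inE /= => /andP[-> _] /=.
  apply/imsetP => -[t tC eq_ts]; case/negP: sC.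
  by rewrite (inj1 s t) // (subsetP CD).
rewrite -def_s; apply/eqP; rewrite eqEsubset subUset sub1set sD CD !andbT.
apply/subsetP => t tD; rewrite in_setU1.
case: (boolP (t \in C)); rewrite ?orbT // orbF => tC.
by apply/eqP/inj2 => //; rewrite (inC t tD tC) def_s.
Qed.

(* Grows one column at a time: for a placement C in the first j columns, the
   extensions to column j contribute q^f [m]_(k+1) + [f] [m]_k, where f is the
   number of free rows and k = j - #|C|. *)
Definition rook_gen (n : nat) (c : 'I_n -> nat) (m j : nat) : {poly int} :=
  \sum_(C : {set square n} | (C \subset col_board c j) && nonattacking C)
    'X^(rook_inv C (col_board c j)) * qffact m (j - #|C|).

Lemma rook_genS (n : nat) (c : 'I_n -> nat) (m : nat) (j : 'I_n) :
  admissible c -> rook_gen c m j.+1 = rook_gen c m j * qint (m + c j - j).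
Proof.
move=> c_adm; rewrite {1}/rook_gen.
(* Placements on j+1 columns are grouped by their restriction C to the first j; an extension adds no
   rook, or one in a free row. *)
rewrite (partition_big (fun D => D :&: col_board c j)
  (fun C => (C \subset col_board c j) && nonattacking C)) /=; last first.
  by move=> D /andP[_ natt]; rewrite subsetIr (nonattacking_sub _ natt) ?subsetIl.
rewrite /rook_gen mulr_suml; apply: eq_bigr => C /andP[CB nattC].
have CB' : C \subset col_board c j.+1.
  exact: subset_trans CB (col_board_sub _ (leqnSn j)).
rewrite (bigD1 C) /=; last by rewrite CB' nattC (setIidPl CB) eqxx.
pose h (r : 'I_n) := (r, j) |: C.
(* The inverse of h reads off the row of the rook in column j; the default j is never reached. *)
rewrite (reindex_onto h (fun D => odflt j [pick r | (r, j) \in D])) /=; last first.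
  move=> D /andP[/andP[/andP[DB nattD] /eqP defC] neDC].
  have [r r_free ->] := add_rook_reverse CB DB nattD defC neDC.
  case: pickP => [r' /=|/(_ r)]; rewrite ?setU11 //.
  by rewrite in_setU1 (negPf (last_col_notin r' CB)) orbF => /eqP[->].
rewrite (eq_bigl (mem (free_rows c j C))); last first.
  move=> r; apply/andP/idP => [[/andP[/andP[/andP[DB nattD] /eqP defC] neDC] _]|r_free].
    have [r' r'_free eq_h] := add_rook_reverse CB DB nattD defC neDC.
    suff -> : r = r' by [].
    have : (r, j) \in h r by rewrite setU11.
    by rewrite eq_h in_setU1 (negPf (last_col_notin r CB)) orbF => /eqP[].
  split.
    rewrite /h add_rook_board // (add_rook_nonattacking CB) // add_rook_trunc // eqxx /=.
    by apply/eqP => eq_hC; have := last_col_notin r CB; rewrite -eq_hC setU11.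
  case: pickP => [r' /=|/(_ r)]; rewrite ?setU11 //.
  by rewrite in_setU1 (negPf (last_col_notin r' CB)) orbF => /eqP[->].
have cardF := card_free_rows c_adm CB nattC.
have le_Cj := card_rooks_le (ltnW (ltn_ord j)) CB nattC.
rewrite rook_inv_no_rook //.
have -> : \sum_(r in free_rows c j C)
      'X^(rook_inv (h r) (col_board c j.+1)) * qffact m (j.+1 - #|h r|) =
    'X^(rook_inv C (col_board c j)) * qint #|free_rows c j C| * qffact m (j - #|C|).
  rewrite -sum_rank_qint mulr_sumr mulr_suml; apply: eq_bigr => r r_free.
  by rewrite rook_inv_add_rook // (card_add_rook _ CB) subSS exprD.
rewrite subSn // qffactS.
(* If m < j - #|C|, the falling factorial kills both sides; otherwise no subtraction is truncated
   and [f + (m-k)] = [f] + q^f [m-k] concludes, for f free rows and k = j - #|C|. *)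
have [le_m|lt_m] := leqP (j - #|C|) m; last first.
  by rewrite qffact_small // !(mulr0, mul0r) addr0.
have -> : (m + c j - j = #|free_rows c j C| + (m - (j - #|C|)))%N by lia.
by rewrite qintD exprD; ring.
Qed.

Lemma rook_gen_prod (n : nat) (c : 'I_n -> nat) (m : nat) : admissible c ->
  rook_gen c m n = \prod_(j < n) qint (m + c j - j).
Proof.
move=> c_adm.
suff main k : (k <= n)%N -> rook_gen c m k = \prod_(j < n | (j < k)%N) qint (m + c j - j).
  by rewrite main //; apply: eq_bigl => j; rewrite ltn_ord.
elim: k => [_|k IH lt_kn].
  have board0 : col_board c 0 = set0 by apply/setP => s; rewrite !inE andbF.
  rewrite /rook_gen board0 (big_pred1 set0) => [|C].
    rewrite sub0n /qffact big_ord0 mulr1 /rook_inv setIdE set0I cards0 expr0.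
    by rewrite big_pred0.
  rewrite subset0; apply: andb_idr => /eqP->.
  by apply/nonattackingP; split=> s t; rewrite inE.
rewrite (rook_genS m (Ordinal lt_kn) c_adm) IH ?(ltnW lt_kn) //.
rewrite [RHS](bigD1 (Ordinal lt_kn)) //= mulrC; congr (_ * _).
by apply: eq_bigl => i; rewrite -val_eqE /= ltnS [RHS]andbC -ltn_neqAle.
Qed.

Lemma sum_qrook (n : nat) (c : 'I_n -> nat) (m : nat) :
  \sum_(k < n.+1) qrook (n - k) (board c) * qffact m k = rook_gen c m n.
Proof.
have boardE : col_board c n = board c by apply/setP => s; rewrite !inE ltn_ord andbT.
rewrite /rook_gen.
rewrite [RHS](partition_big
  (fun C : {set square n} => inord (n - #|C|) : 'I_n.+1) predT) //=.
apply: eq_bigr => k _; rewrite /qrook mulr_suml boardE.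
apply: eq_big => [C|C /and3P[_ /eqP -> _]]; last first.
  by congr (_ * qffact m _); have := ltn_ord k; lia.
case: (boolP (C \subset board c)) => //= CB.
case: (boolP (nonattacking C)) => nattC; rewrite ?andbF ?andbT //=.
have := @card_rooks_le n c n C (leqnn n); rewrite boardE => /(_ CB nattC) le_Cn.
rewrite -val_eqE /= inordK ?ltnS ?leq_subr //.
have := ltn_ord k; move: #|C| le_Cn => d le_dn lt_kn.
by apply/eqP/eqP; lia.
Qed.

(** * Inserting factors *)

(* The junk value 0 at negative z is harmless: there it only ever multiplies a
   factor that vanishes. *)
Definition qintz (z : int) : {poly int} := if z is Posz k then qint k else 0.

Lemma qintzM_neq0 (z : int) (f : {poly int}) : qintz z * f != 0 -> f != 0 /\ 0 < z.
Proof.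
move=> nz; split; first by apply: contraNneq nz => ->; rewrite mulr0.
by case: z nz => [[|z]|z] //=; rewrite ?qint0 mul0r eqxx.
Qed.

(** Invariant of the insertion, with [p j] in the role of T_(n-j). The support bounds are carried
    along to keep the q-integers and exponents of the next insertion nonnegative. *)
Record hit_family (s : seq int) (p : nat -> {poly int}) : Prop := HitFamily {
  hit_centered : forall j,
    centered (\sum_(a <- s) a + (size s)%:Z * (j%:Z - 1)) (p j);
  hit_le_size : forall j, p j != 0 -> (j <= size s)%N;
  hit_support_pos : forall j a, p j != 0 -> a \in s -> 0 < a ->
    j%:Z + a <= (size s)%:Z;
  hit_support_npos : forall j a, p j != 0 -> a \in s -> a <= 0 -> 1 <= a + j%:Z;
  hit_prod : forall m : nat, \prod_(a <- s) qintz (m%:Z + a) =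
    \sum_(j < (size s).+1) p j * qbin (size s + m - j) (size s) }.

(** The absolute value only casts the exponent to a natural number: in [hit_family_cons], a + i is
    nonnegative wherever [p i] is nonzero. *)
Definition insert_root (n : nat) (a : int) (p : nat -> {poly int}) (j : nat) :=
  qintz (a + j%:Z) * p j +
  (if j is i.+1 then 'X^(`|a + i%:Z|) * (qintz (n.+1%:Z - a - i%:Z) * p i)
   else 0).

Lemma hit_family_nil : hit_family [::] (fun j => if j is 0 then 1 else 0).
Proof.
split=> [[|j]|[|j]|[|j] a|[|j] a|m] //=; rewrite ?eqxx //; last first.
- by rewrite big_nil big_ord1 mul1r qbin0.
- exact: centered0.
- rewrite big_nil mul0r addr0 => i j; case: i j => [[|i]|i] [[|j]|j] //=;
  by rewrite ?coef1 //=; lia.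
Qed.

Lemma hit_family_cons (a : int) (s : seq int) (p : nat -> {poly int}) :
  hit_family s p ->
  (1 < a -> a - 1 \in s) -> (a < 0 -> a + 1 \in s) ->
  hit_family (a :: s) (insert_root (size s) a p).
Proof.
case=> p_cent p_size p_pos p_npos p_prod a_pos a_neg.
(* The neighbour a+1 or a-1 already in s gives, through its support bound, precisely [lo] or [hi];
   for a in {0, 1} the range 0 <= j <= size s suffices. *)
have lo j : p j != 0 -> 0 <= a + j%:Z.
  move=> pj; have [a_lt0|] := ltP a 0; last by lia.
  have := p_npos j _ pj (a_neg a_lt0); lia.
have hi j : p j != 0 -> j%:Z + a <= (size s).+1%:Z.
  move=> pj; have := p_size j pj; have [a_gt1|] := ltP 1 a; last by lia.
  have := p_pos j _ pj (a_pos a_gt1); lia.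
(* A nonzero new term has a positive q-integer factor, and this positivity is the support bound for
   the new root a. *)
have cases j : insert_root (size s) a p j != 0 ->
    (p j != 0 /\ 0 < a + j%:Z) \/
    (exists2 i, j = i.+1 & p i != 0 /\ 0 < (size s).+1%:Z - a - i%:Z).
  rewrite /insert_root; have [->|/qintzM_neq0 nz _] := eqVneq (qintz (a + j%:Z) * p j) 0.
    rewrite add0r; case: j => [|i]; rewrite ?eqxx // => nz.
    right; exists i => //; apply: qintzM_neq0.
    by apply: contraNneq nz => ->; rewrite mulr0.
  by left.
split=> [j|j|j b|j b|m] /=.
(* With d_j the old centre parameter, both d_j + (a+j) - 1 and d_(j-1) + (n+2-a-j) - 1 + 2(a+j-1)
   equal the new one, where n is the size of s. *)
- rewrite big_cons /insert_root; apply: centeredD.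
    have [->|pj] := eqVneq (p j) 0; first by rewrite mulr0; apply: centered0.
    have := lo j pj; case def_k: (a + j%:Z) => [k|k] // _ /=.
    have := centered_qint (m := k) (p_cent j); congr centered.
    by rewrite (_ : a = k%:Z - j%:Z) ?intS; [ring|lia].
  case: j => [|i]; first exact: centered0.
  have [->|pi] := eqVneq (p i) 0; first by rewrite !mulr0; apply: centered0.
  have := lo i pi; have := hi i pi.
  case def_k: (_ - i%:Z) => [k|k]; last by lia.
  move=> _ le0; have := centeredXn (k := `|a + i%:Z|) (centered_qint (m := k) (p_cent i)).
  congr centered; rewrite gez0_abs //.
  by rewrite -def_k !intS; ring.
- by case/cases=> [[pj _]|[i -> [pi _]]]; [have := p_size _ pj|have := p_size _ pi]; lia.
- case/cases=> [[pj gt0]|[i -> [pi gt0]]]; rewrite inE => /orP[/eqP->|bs] b_gt0.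
  + have := p_size _ pj; have [a_gt1|] := ltP 1 a; last by lia.
    have := p_pos j _ pj (a_pos a_gt1); lia.
  + by have := p_pos _ _ pj bs b_gt0; lia.
  + by lia.
  + by have := p_pos _ _ pi bs b_gt0; lia.
- case/cases=> [[pj gt0]|[i -> [pi gt0]]]; rewrite inE => /orP[/eqP->|bs] b_le0.
  + by lia.
  + by have := p_npos _ _ pj bs b_le0; lia.
  + by have := lo i pi; lia.
  + by have := p_npos _ _ pi bs b_le0; lia.
set n := size s.
rewrite big_cons p_prod mulr_sumr -/n.
(* Collecting the terms in [p j] reduces the product formula to [qint_mul_qbin] for each j
   separately. *)
have -> : \sum_(j < n.+2) insert_root n a p j * qbin (n.+1 + m - j) n.+1 =
  \sum_(j < n.+1) (qintz (a + j%:Z) * qbin (n.+1 + m - j) n.+1 +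
     'X^(`|a + j%:Z|) * qintz (n.+1%:Z - a - j%:Z) * qbin (n + m - j) n.+1) * p j.
  under eq_bigr do rewrite /insert_root mulrDl.
  under [RHS]eq_bigr do rewrite mulrDl.
  rewrite !big_split /=; congr (_ + _).
    rewrite big_ord_recr /= (_ : p n.+1 = 0) ?mulr0 ?mul0r ?addr0.
      by apply: eq_bigr => j _; rewrite mulrAC.
    by apply: contraTeq isT => /p_size; rewrite ltnn.
  rewrite big_ord_recl mul0r add0r; apply: eq_bigr => j _.
  by rewrite lift0 addSn subSS; ring.
apply: eq_bigr => j _; have [->|pj] := eqVneq (p j) 0; first by rewrite mul0r !mulr0.
rewrite [p j * _]mulrC mulrA; congr (_ * _).
have [lt_mj|le_jm] := ltnP m j.
  by have := ltn_ord j => lt_jn; rewrite !qbin_small ?mulr0 ?addr0 //; lia.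
have [A defA] : exists A : nat, a + j%:Z = A%:Z
  by exists (absz (a + j%:Z)); have := lo j pj; lia.
have le_An : (A <= n.+1)%N by have := hi j pj; lia.
have := qint_mul_qbin (m - j) le_An.
have -> : m%:Z + a = (m - j + A)%N by lia.
have -> : n.+1%:Z - a - j%:Z = (n.+1 - A)%N by lia.
by rewrite defA -!addnBA.
Qed.

Lemma hit_family_perm (s t : seq int) (p : nat -> {poly int}) :
  perm_eq s t -> hit_family s p -> hit_family t p.
Proof.
move=> eq_st [p_cent p_size p_pos p_npos p_prod].
have eq_size := perm_size eq_st; have eq_mem := perm_mem eq_st.
split=> [j|j|j a|j a|m]; rewrite -?eq_size -?eq_mem; auto.
- by rewrite -(perm_big _ eq_st).
- by rewrite -(perm_big _ eq_st).
Qed.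

Definition step_closed (s : seq int) : Prop :=
  forall a, a \in s -> (1 < a -> a - 1 \in s) /\ (a < 0 -> a + 1 \in s).

(** The root farthest from 1/2 is inserted last. The neighbours required by [step_closed] are
    strictly closer to 1/2, so they are never the removed value. *)
Lemma hit_family_exists (s : seq int) :
  step_closed s -> exists p, hit_family s p.
Proof.
have [n le_sn] := ubnP (size s); elim: n s le_sn => // n IH [|b s0] lt_sn clos.
  by exists (fun j => if j is 0 then 1 else 0); apply: hit_family_nil.
set s := b :: s0 in lt_sn clos *.
have [a a_s a_max] : exists2 a, a \in s & {in s, forall c, `|2 * c - 1| <= `|2 * a - 1|}.
  rewrite /s; elim: (s0) (b) => [|c t IHt] d.
    by exists d; rewrite ?mem_head // => x; rewrite inE => /eqP->.
  have [a a_t a_max] := IHt c.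
  have [le_da|lt_ad] := leP `|2 * d - 1| `|2 * a - 1|.
    exists a; first by rewrite inE a_t orbT.
    by move=> x; rewrite inE => /orP[/eqP->|/a_max].
  exists d; first exact: mem_head.
  move=> x; rewrite inE => /orP[/eqP->//|/a_max le_x].
  exact: le_trans le_x (ltW lt_ad).
have eq_s := perm_to_rem a_s.
have rem_mem c : c \in s -> c != a -> c \in rem a s.
  by rewrite (perm_mem eq_s) inE => /orP[->|].
have [|c c_r|p p_hit] := IH (rem a s).
- by rewrite size_rem //; move: lt_sn; rewrite /s /=; lia.
- have [c1 c2] := clos c (mem_rem c_r).
  have := a_max c (mem_rem c_r) => le_ca.
  by split=> ltc; apply: rem_mem; [exact: c1|lia|exact: c2|lia].
- exists (insert_root (size (rem a s)) a p).
  apply: (hit_family_perm (s := a :: rem a s)); first by rewrite perm_sym.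
  have [a1 a2] := clos a a_s.
  by apply: hit_family_cons p_hit _ _ => lta; apply: rem_mem;
    [exact: a1|lia|exact: a2|lia].
Qed.

(** * Ferrers boards *)

(** Upward jumps are arbitrary, but a descent by at most 1 cannot skip v: if f j > v >= f (j+1),
    then f (j+1) = v. *)
Lemma discrete_ivt (f : nat -> int) (v : int) (i j : nat) :
  (forall t, (i <= t < j)%N -> f t - 1 <= f t.+1) ->
  (i <= j)%N -> v <= f i -> f j <= v -> exists2 t, (i <= t <= j)%N & f t = v.
Proof.
elim: j => [|j IH] f_step le_ij le_vi le_jv.
  move: le_ij le_vi; rewrite leqn0 => /eqP-> le_v0.
  by exists 0%N => //; apply/eqP; rewrite eq_le le_v0 le_jv.
have [eq_ij|ne_ij] := eqVneq i j.+1.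
  by exists i; [lia|move: le_vi; rewrite eq_ij; lia].
have [le_fj|lt_fj] := leP (f j) v.
  have [t le_t <-] : exists2 t, (i <= t <= j)%N & f t = v.
    by apply: IH => // [t le_t|]; [apply: f_step|]; lia.
  by exists t; lia.
exists j.+1; first by lia.
by have := f_step j; lia.
Qed.

Definition board_roots (n : nat) (c : 'I_n -> nat) : seq int :=
  [seq (c i)%:Z - i%:Z | i <- enum 'I_n].

Lemma size_board_roots (n : nat) (c : 'I_n -> nat) : size (board_roots c) = n.
Proof. by rewrite size_map size_enum_ord. Qed.

Lemma step_closed_board (n : nat) (c : 'I_n -> nat) :
  admissible c -> step_closed (board_roots c).
Proof.
case: n c => [|n] c [c_mono c_le] a /mapP[i _ ->]; first by case: i.
pose f t : int := (c (inord t))%:Z - t%:Z.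
have f_step t : (t < n)%N -> f t - 1 <= f t.+1.
  move=> lt_tn; have : ((inord t : 'I_n.+1) <= (inord t.+1 : 'I_n.+1))%N.
    by rewrite !inordK; lia.
  by move/c_mono; rewrite /f; lia.
have fE (t : 'I_n.+1) : f t = (c t)%:Z - t%:Z by rewrite /f inord_val.
have f_mem v (t : nat) : (t <= n)%N -> f t = v -> v \in board_roots c.
  move=> le_tn <-; rewrite -[t](@inordK n) ?ltnS // fE.
  by apply: map_f; rewrite mem_enum.
have lt_i := ltn_ord i; rewrite -fE; split=> [gt1|lt0].
  (* To the right, f ends at most at 1 because the last of the n+1 columns has height at most n+1;
     to the left, f starts at f 0 >= 0. *)
  have [t le_t /f_mem] : exists2 t, (i <= t <= n)%N & f t = f i - 1.
    apply: discrete_ivt => [t le_t|||]; [apply: f_step| | |]; try lia.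
    by have := c_le ord_max; have := fE ord_max; rewrite /=; lia.
  by apply; lia.
have [t le_t /f_mem] : exists2 t, (0 <= t <= i)%N & f t = f i + 1.
  by apply: discrete_ivt => [t le_t|||]; [apply: f_step| |rewrite {2}/f|]; lia.
by apply; lia.
Qed.

Theorem theorem6 (n : nat) (c : 'I_n -> nat) (k : nat) :
  (0 < n)%N -> admissible c -> (k <= n)%N ->
  zsu (hit_darga k c) (qhit k (board c)).
Proof.
move=> _ c_adm le_kn; apply: centered_zsu.
have [p p_hit] := hit_family_exists (step_closed_board c_adm).
have := hit_prod p_hit; rewrite size_board_roots => p_prod.
have -> : qhit k (board c) = p (n - k)%N.
  (* The polynomial with coefficients [p (n - t)] has the same evaluations as [qhit_gen], so
     injectivity identifies the coefficients. *)
  have coefP := coef_poly n.+1 (fun t => p (n - t)%N).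
  rewrite -[p _]/(if true then p (n - k)%N else 0) -{1}(_ : (k < n.+1)%N = true) //.
  rewrite -coefP; apply: (@qbin_eval_inj n) => // m.
  rewrite qbin_eval_hit sum_qrook rook_gen_prod //.
  transitivity (\prod_(a <- board_roots c) qintz (m%:Z + a)).
    rewrite big_map big_enum /=; apply: eq_bigr => i _.
    (* For m + c_i - i negative, [qintz] and the truncated difference both give 0. *)
    case def_a: (m%:Z + _) => [d|d] /=; first by congr qint; lia.
    by rewrite (_ : _ - _ = 0)%N ?qint0 //; lia.
  rewrite p_prod /qbin_eval (reindex_inj rev_ord_inj) /=.
  apply: eq_bigr => i _; rewrite coefP ltn_ord subSS.
  by congr (_ * qbin _ _); have := ltn_ord i; lia.
(* The roots sum to Area - C(n,2), and C(n+1,2) = C(n,2) + n turns the centre parameter into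
   [hit_darga]. *)
have := @hit_centered _ _ p_hit (n - k)%N; congr centered.
rewrite size_board_roots big_map big_enum /= sumrB /hit_darga binS bin1.
have PoszS (f : 'I_n -> nat) : \sum_(i < n) (f i)%:Z = (\sum_(i < n) f i)%N%:Z.
  by rewrite (big_morph Posz PoszD (erefl (Posz 0))).
rewrite !PoszS -/(area c) -(big_mkord xpredT id) bin2_sum.
by rewrite -subzn // PoszD; ring.
Qed.
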